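(* For every (complex) unitary matrix $A$, $$\mu(A)\ge\frac{1}{(\max_{i,j}|A(ij)|)^2}.$$ If $A$ is an $N\times N$ matrix such that $\sqrt N A$ is a Hadamard matrix, then $\mu(A)=N$.
   Context: For an $n\times n$ unitary matrix $A$, the uncertainty constant of $A$ is $\mu(A):=\min_{f\in\mathbb C^n\setminus\{0\}}|\mathrm{supp}(f)|\cdot|\mathrm{supp}(Af)|$, where $\mathrm{supp}(f)=\{k:f(k)\ne0\}$ and $|\cdot|$ of a set is its cardinality. A Hadamard matrix is a square matrix with all entries (possibly complex) of absolute value one and mutually orthogonal rows/columns; thus if $\sqrt NA$ is an $N\times N$ Hadamard matrix then $A$ is unitary. *)

(* Defs.v *)
From HB Require Import structures.
From mathcomp Require Import all_boot all_order all_algebra.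
From mathcomp Require Import boolp reals.
From mathcomp Require Import complex.

Set Implicit Arguments.
Unset Strict Implicit.
Unset Printing Implicit Defensive.

Import Order.TTheory GRing.Theory Num.Theory.
Local Open Scope ring_scope.

Definition supp (R : realType) (n : nat) (f : 'cV[R[i]]_n) : {set 'I_n} :=
  [set k | f k 0 != 0].

Definition uncertainty_value (R : realType) (n : nat) (A : 'M[R[i]]_n)
    (m : nat) : Prop :=
  exists2 f : 'cV[R[i]]_n, f != 0 & m = (#|supp f| * #|supp (A *m f)|)%N.

Lemma uncertainty_value_ex (R : realType) (n : nat) (A : 'M[R[i]]_n.+1) :
  exists m : nat, `[< uncertainty_value A m >].
Proof.
pose f : 'cV[R[i]]_n.+1 := const_mx 1.
exists (#|supp f| * #|supp (A *m f)|)%N; apply/asboolP; exists f => //.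
by apply/eqP => /matrixP/(_ 0 0); rewrite !mxE => /eqP; rewrite oner_eq0.
Qed.

(* The size is n.+1 because no nonzero vector exists in size 0, where the
   minimum would be over the empty set. *)
Definition uncertainty (R : realType) (n : nat) (A : 'M[R[i]]_n.+1) : nat :=
  ex_minn (uncertainty_value_ex A).

Lemma uncertaintyP (R : realType) (n : nat) (A : 'M[R[i]]_n.+1) :
  uncertainty_value A (uncertainty A) /\
  (forall f : 'cV[R[i]]_n.+1, f != 0 ->
     (uncertainty A <= #|supp f| * #|supp (A *m f)|)%N).
Proof.
rewrite /uncertainty; case: ex_minnP => m /asboolP Am m_min; split=> // f f0.
by apply: m_min; apply/asboolP; exists f.
Qed.

(* [normc] is the modulus with values in [R]; the norm of [R[i]] would take
   its values in [R[i]]. The default 0 is harmless since moduli are >= 0. *)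
Definition max_modulus (R : realType) (n : nat) (A : 'M[R[i]]_n) : R :=
  \big[Num.max/0]_(i < n) \big[Num.max/0]_(j < n) Normc.normc (A i j).

Definition is_hadamard (R : realType) (n : nat) (H : 'M[R[i]]_n) : Prop :=
  (forall i j, Normc.normc (H i j) = 1) /\
  (forall i j, i != j -> \sum_k H i k * (H j k)^* = 0).

(* Orthogonality of the columns follows from that of the rows. *)
Lemma is_hadamard_col (R : realType) (n : nat) (H : 'M[R[i]]_n) :
  is_hadamard H -> forall i j, i != j -> \sum_k H k i * (H k j)^* = 0.
Proof.
move=> [H1 Hrow] i j neq_ij.
have n0 : n%:R != 0 :> R[i].
  by rewrite pnatr_eq0; case: n i {j neq_ij H H1 Hrow} => // -[].
pose K : 'M[R[i]]_n := \matrix_(k, l) (H l k)^*.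
have HK : H *m (n%:R^-1 *: K) = 1%:M.
  apply/matrixP => k l; rewrite -scalemxAr !mxE.
  under eq_bigr do rewrite mxE.
  have [->|/Hrow->] := eqVneq k l; last by rewrite mulr0.
  have Hll m : H l m * (H l m)^* = 1.
    rewrite -normCK normc_def.
    have := H1 l m; rewrite /Normc.normc; case: (H l m) => a b /= ->.
    by rewrite expr1n.
  by under eq_bigr do rewrite Hll; rewrite sumr_const card_ord mulVf.
have /matrixP/(_ j i) := mulmx1C HK.
rewrite -scalemxAl !mxE eq_sym (negPf neq_ij) => /eqP.
rewrite mulf_eq0 invr_eq0 (negPf n0) /= => /eqP sum0.
by rewrite -[RHS]sum0; apply: eq_bigr => k _; rewrite mxE mulrC.
Qed.

(* Main.v *)
(* The l1-norms of [f] and [A f] bound each other: a single entry of [A f] is at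
   most [max |A i j|] times the l1-norm of [f], and summing over the support of
   [A f] gives |A f|_1 <= max |A i j| * |supp (A f)| * |f|_1. The same holds for
   the inverse of [A], whose entries have the same moduli. Multiplying the two
   bounds and cancelling |f|_1 gives the inequality. In the Hadamard case the
   maximum is 1 / sqrt N, and a standard basis vector attains the bound. *)

Require Import Defs.
From HB Require Import structures.
From mathcomp Require Import all_boot all_order all_algebra.
From mathcomp Require Import boolp reals.
From mathcomp Require Import complex.

Set Implicit Arguments.
Unset Strict Implicit.
Unset Printing Implicit Defensive.

Import Order.TTheory GRing.Theory Num.Theory.
Local Open Scope ring_scope.

Lemma l1_norm_le_supp (R : realType) (m : nat) (A : 'M[R[i]]_m)
    (f : 'cV[R[i]]_m) (M : R[i]) :
  (forall i j, `|A i j| <= M) ->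
  \sum_i `|(A *m f) i 0| <= #|supp (A *m f)|%:R * M * \sum_j `|f j 0|.
Proof.
move=> AM; rewrite (bigID (mem (supp (A *m f)))) /= [X in _ + X]big1 ?addr0.
  rewrite -mulrA mulr_natl -sumr_const; apply: ler_sum => i _.
  rewrite mxE mulr_sumr; apply: le_trans (ler_norm_sum _ _ _) _.
  by apply: ler_sum => j _; rewrite normrM ler_wpM2r.
by move=> i; rewrite inE negbK => /eqP->; rewrite normr0.
Qed.

Lemma supp_mul_ge1 (R : realType) (m : nat) (A B : 'M[R[i]]_m)
    (f : 'cV[R[i]]_m) (M : R[i]) :
  B *m A = 1%:M -> 0 <= M ->
  (forall i j, `|A i j| <= M) -> (forall i j, `|B i j| <= M) -> f != 0 ->
  1 <= (#|supp f| * #|supp (A *m f)|)%:R * M ^+ 2.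
Proof.
move=> BA M0 AM BM f0.
have f1_gt0 : 0 < \sum_j `|f j 0|.
  rewrite lt_def sumr_ge0 // andbT; apply: contra f0.
  rewrite psumr_eq0 // => /allP f_eq0; apply/eqP/matrixP => j k.
  rewrite ord1 mxE; apply/eqP; rewrite -normr_eq0.
  exact: f_eq0 (mem_index_enum j).
(* Both sides are multiplied by the l1-norm of [f], so that the two l1 bounds can be chained. *)
rewrite -(ler_pM2r f1_gt0) mul1r.
(* For [B] acting on [A *m f], the support in the bound is that of [f] itself. *)
have := l1_norm_le_supp (A *m f) BM; rewrite mulmxA BA mul1mx.
move=> /le_trans; apply.
apply: le_trans (ler_wpM2l _ (l1_norm_le_supp f AM)) _; first exact: mulr_ge0.
by rewrite natrM expr2 !mulrA (mulrAC _ M _%:R).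
Qed.

Lemma normC_normc (R : realType) (z : R[i]) : `|z| = (Normc.normc z)%:C%C.
Proof. by case: z. Qed.

Lemma normc_le_max_modulus (R : realType) (m : nat) (A : 'M[R[i]]_m) i j :
  Normc.normc (A i j) <= max_modulus A.
Proof.
apply: le_trans (le_bigmax_cond _ (fun i => _) (isT : xpredT i)).
exact: (le_bigmax_cond _ (fun j => Normc.normc (A i j)) (isT : xpredT j)).
Qed.

(** The inverse of a unitary matrix is its conjugate transpose, so [M] bounds its entries too. *)
Lemma unitary_supp_mul_ge1 (R : realType) (m : nat) (A : 'M[R[i]]_m)
    (f : 'cV[R[i]]_m) (M : R[i]) :
  A \is unitarymx -> 0 <= M -> (forall i j, `|A i j| <= M) -> f != 0 ->
  1 <= (#|supp f| * #|supp (A *m f)|)%:R * M ^+ 2.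
Proof.
move=> /unitarymxP AAt M0 AM.
apply: (supp_mul_ge1 (mulmx1C AAt)) => // i j.
by rewrite !mxE norm_conjC.
Qed.

Lemma unitary_of_hadamard (R : realType) (n : nat) (A : 'M[R[i]]_n.+1) :
  is_hadamard ((Num.sqrt n.+1%:R)%:C%C *: A) ->
  A \is unitarymx /\ forall i j, `|A i j| ^+ 2 = n.+1%:R^-1.
Proof.
set c := (_%:C)%C => -[H1 Hrow].
have cc : c * c^* = n.+1%:R.
  rewrite -normCK normC_normc /= expr0n addr0 sqrtr_sqr ger0_norm ?sqrtr_ge0 //.
  by rewrite -rmorphXn /= sqr_sqrtr // rmorph_nat.
have N0 : n.+1%:R != 0 :> R[i] by rewrite pnatr_eq0.
have A2 i j : `|A i j| ^+ 2 = n.+1%:R^-1.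
  have := H1 i j; rewrite mxE => /(congr1 (fun x => x%:C%C)).
  rewrite -normC_normc => /(congr1 (fun x => x ^+ 2)).
  rewrite normrM exprMn (normCK c) cc expr1n => h.
  by apply: (mulfI N0); rewrite h divff.
split=> //; apply/unitarymxP/matrixP => i j; rewrite !mxE.
have [->|/Hrow] := eqVneq i j.
  under eq_bigr do rewrite !mxE -normCK A2.
  by rewrite sumr_const card_ord -[LHS]mulr_natr mulVf.
(* Row orthogonality of [c *: A] is that of [A] times the nonzero factor [c * c^*], which
   cancels. *)
under eq_bigr do rewrite !mxE rmorphM mulrACA cc.
rewrite -mulr_sumr => /eqP; rewrite mulf_eq0 (negPf N0) => /eqP sum0.
by rewrite -[RHS]sum0; apply: eq_bigr => k _; rewrite !mxE.
Qed.

Theorem corollary5p8 (R : realType) :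
  (forall (n : nat) (A : 'M[R[i]]_n.+1),
     A \is unitarymx ->
     1 / max_modulus A ^+ 2 <= (uncertainty A)%:R) /\
  (forall (n : nat) (A : 'M[R[i]]_n.+1),
     is_hadamard ((Num.sqrt n.+1%:R)%:C%C *: A) ->
     uncertainty A = n.+1).
Proof.
split=> n A.
  move=> Au; have [[f f0 ->] _] := uncertaintyP A.
  have M0 : 0 <= max_modulus A.
    apply: le_trans (normc_le_max_modulus A 0 0).
    by rewrite -lecR -normC_normc; exact: normr_ge0.
  have : 1 <= (#|supp f| * #|supp (A *m f)|)%:R * (max_modulus A)%:C%C ^+ 2.
    apply: unitary_supp_mul_ge1 => // [|i j]; first by rewrite lecR.
    by rewrite normC_normc lecR normc_le_max_modulus.
  (* All terms are real, so the inequality descends from [R[i]] to [R]. *)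
  rewrite -(rmorph_nat (real_complex R)) -rmorphXn -rmorphM /= lecR => le1.
  rewrite ler_pdivrMr // exprn_gt0 // lt_def M0 andbT.
  (* A zero maximum would turn [le1] into [1 <= 0]. *)
  by apply: contraTneq le1 => ->; rewrite expr0n mulr0 ler10.
move=> /unitary_of_hadamard[Au A2].
have [[f f0 uE] umin] := uncertaintyP A.
apply/eqP; rewrite eqn_leq; apply/andP; split.
  (* A basis vector has support of size 1, and its image has support of size at most [n.+1]. *)
  have e0 : delta_mx 0 0 != 0 :> 'cV[R[i]]_n.+1.
    by apply/eqP => /matrixP/(_ 0 0)/eqP; rewrite !mxE oner_eq0.
  apply: leq_trans (umin _ e0) _.
  have -> : supp (delta_mx 0 0 : 'cV[R[i]]_n.+1) = [set 0].
    by apply/setP => k; rewrite !inE mxE andbT pnatr_eq0; case: (k == 0).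
  by rewrite cards1 mul1n -[leqRHS]card_ord max_card.
(* All entries have the same modulus, so that of [A 0 0] serves as [M], with square [n.+1%:R^-1]. *)
have := unitary_supp_mul_ge1 Au (normr_ge0 (A 0 0)) _ f0.
rewrite -uE A2 ler_pdivlMr ?ltr0Sn // mul1r ler_nat; apply=> i j.
by rewrite -(@ler_pXn2r _ 2) ?nnegrE // !A2.
Qed.
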